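(* Let $T>0$ and let $q\in L^2([0,T],\mathbb{C})$ be a periodic potential. Then the sequence $(z_k)_{k\in\mathbb{Z}}$ of perturbed Fourier coefficients of $q$ lies in $\ell^2(\mathbb{Z})$.
   Context: For $q\in L^2([0,T],\mathbb{C})$ (thought of as extended $T$-periodically) let $F(t,\lambda)$, $\lambda\in\mathbb{C}$, solve $\frac{d}{dt}F=F\alpha$, $F(0,\lambda)=\mathbb{1}$, with $\alpha=\frac12\begin{pmatrix}\mathbf{i}\lambda&q\\-\bar q&-\mathbf{i}\lambda\end{pmatrix}$, and let $M(\lambda)=F(T,\lambda)=\begin{pmatrix}a&b\\c&d\end{pmatrix}(\lambda)$ with entire entries. The zeros (with multiplicities) of the entire function $a-d$ can be enumerated by a sequence $(\lambda_k)_{k\in\mathbb{Z}}$ with $(\lambda_k-\lambda_{k,0})_k\in\ell^2(\mathbb{Z})$, where $\lambda_{k,0}=\frac{2\pi}{T}k$. The perturbed Fourier coefficients of $q$ are $z_k=2(-1)^kb(\lambda_k)$. *)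

(* Defs.v *)
From HB Require Import structures.
From mathcomp Require Import all_boot all_order all_algebra.
From mathcomp Require Import all_classical all_reals all_analysis.
From mathcomp Require Import complex.
Import Order.TTheory GRing.Theory Num.Theory.
Import numFieldNormedType.Exports.

Set Implicit Arguments.
Unset Strict Implicit.
Unset Printing Implicit Defensive.

Local Open Scope classical_set_scope.
Local Open Scope ring_scope.
Local Open Scope complex_scope.

(* The norm `|z| of R[i] takes its values in R[i]; this one is real-valued. *)
Definition modulus (R : realType) (z : R[i]) : R := complex.Re `|z|.

Definition in_L2 (R : realType) (T : R) (q : R -> R[i]) : Prop :=
  [/\ measurable_fun `[0, T] (fun t => complex.Re (q t)),
      measurable_fun `[0, T] (fun t => complex.Im (q t)) &
      (\int[@lebesgue_measure R]_(t in `[0%R, T]) (modulus (q t) ^+ 2)%:E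
         < +oo)%E].

Definition in_l2 (R : realType) (z : int -> R[i]) : Prop :=
  summable [set: int] (fun k => (modulus (z k) ^+ 2)%:E).

Definition abs_continuous (R : realType) (a b : R) (f : R -> R[i]) : Prop :=
  forall e : R, 0 < e -> exists2 d : R, 0 < d &
    forall (n : nat) (u v : 'I_n -> R),
      (forall i, [/\ a <= u i, u i <= v i & v i <= b]) ->
      trivIset [set: 'I_n] (fun i => `]u i, v i[%classic) ->
      \sum_(i < n) (v i - u i) < d ->
      \sum_(i < n) modulus (f (v i) - f (u i)) < e.

Definition has_cderive (R : realType) (f : R -> R[i]) (t : R) (l : R[i])
    : Prop :=
  is_derive t 1 (fun s => complex.Re (f s)) (complex.Re l) /\
  is_derive t 1 (fun s => complex.Im (f s)) (complex.Im l).

Definition mx2 (K : Type) (a b c d : K) : 'M[K]_2 :=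
  \matrix_(i < 2, j < 2)
    if i == 0 then (if j == 0 then a else b) else (if j == 0 then c else d).

Definition alpha (R : realType) (q : R -> R[i]) (t : R) (l : R[i])
    : 'M[R[i]]_2 :=
  2^-1 *: mx2 ((0 +i* 1) * l) (q t) (- conjc (q t)) (- ((0 +i* 1) * l)).

(* Since q is only square-integrable, the equation F' = F alpha is understood
   in the sense of Caratheodory: F is absolutely continuous in t on [0, T] and
   the equation holds at almost every t. *)
Definition is_fundamental_solution (R : realType) (T : R) (q : R -> R[i])
    (F : R -> R[i] -> 'M[R[i]]_2) : Prop :=
  forall l : R[i],
    [/\ F 0 l = 1%:M,
        forall i j, abs_continuous 0 T (fun t => F t l i j) &
        {ae @lebesgue_measure R, forall t, 0 < t < T -> forall i j,
           has_cderive (fun s => F s l i j) t ((F t l *m alpha q t l) i j)}].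

(* m = 0 means that f is holomorphic near w with f w != 0. *)
Definition has_zero_order (R : realType) (f : R[i] -> R[i]) (w : R[i])
    (m : nat) : Prop :=
  exists2 g : R[i] -> R[i],
    (\forall z \near (w : R[i]^o), derivable (g : R[i]^o -> R[i]^o) z 1) /\
    g w != 0 &
    \forall z \near (w : R[i]^o), f z = (z - w) ^+ m * g z.

Definition enumerates_zeros (R : realType) (f : R[i] -> R[i])
    (lam : int -> R[i]) : Prop :=
  forall w : R[i], exists2 m : nat,
    has_zero_order f w m & ([set k : int | lam k = w] #= `I_m)%card.

Definition free_zero (R : realType) (T : R) (k : int) : R[i] :=
  (2 * pi / T * k%:~R)%:C.

Definition pert_fourier (R : realType) (M : R[i] -> 'M[R[i]]_2)
    (lam : int -> R[i]) (k : int) : R[i] :=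
  2 * (-1) ^ k * M (lam k) 0 1.

(* Main.v *)
(* Write M's first row as (a, b), and let f, g be the first row of F, so that
   g T = b.  Put lambda_k = nu_k + e_k with nu_k = 2 pi k / T, and let w_k be the
   primitive of q e^(i nu_k t) / 2, the truncated Fourier coefficient of q.
   - Bessel's inequality bounds the sum over k of |w_k t|^2 by T |q|_2^2 / 4,
     uniformly in t in [0, T].
   - |f|^2 + |g|^2 is bounded uniformly in k, since Im lambda_k is bounded and the
     potential acts by a skew-Hermitian matrix.
   - p g - w_k p^* f with p = e^(i nu_k t / 2) has derivative of size
     O(|e_k| + |q| |w_k|), so |b(lambda_k)|^2 is at most a constant times
     |e_k|^2 + |w_k T|^2 + int_0^T |w_k|^2, which is summable.
   All integral estimates are instances of one fact: an absolutely continuous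
   function whose derivative is almost everywhere nonpositive is nonincreasing. *)
Require Import Defs.
From HB Require Import structures.
From mathcomp Require Import all_boot all_order all_algebra.
From mathcomp Require Import all_classical all_reals all_analysis.
From mathcomp Require Import measurable_realfun complex.
From mathcomp Require Import ring lra.
Import Order.TTheory GRing.Theory Num.Theory.
Import numFieldNormedType.Exports.
Set Implicit Arguments.
Unset Strict Implicit.
Unset Printing Implicit Defensive.

Local Open Scope classical_set_scope.
Local Open Scope ring_scope.
Local Open Scope complex_scope.

(** * Absolutely continuous functions with nonpositive derivative *)

(** Supremum argument: goodness around the supremum of the points reachable from [a] carries a chain
    past it unless it is [b]. Steps need only be good when they contain the tag [c], which is the
    form that pointwise derivative information takes. *)
Lemma cousin_chain (R : realType) (a b : R) (good : R -> R -> Prop) :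
  a <= b ->
  (forall c, a <= c <= b -> exists2 d : R, 0 < d &
     forall u v, a <= u <= c -> c <= v <= b -> c - d < u -> v < c + d ->
     good u v) ->
  exists (n : nat) (x : nat -> R), [/\ x 0%N = a, x n = b &
    forall i, (i < n)%N -> x i <= x i.+1 /\ good (x i) (x i.+1)].
Proof.
move=> ab hgood.
pose chain y := exists (n : nat) (x : nat -> R), [/\ x 0%N = a, x n = y &
    forall i, (i < n)%N -> x i <= x i.+1 /\ good (x i) (x i.+1)].
pose S := [set y | a <= y <= b /\ chain y].
have Sa : S a by split; [rewrite lexx|exists 0%N, (fun=> a)].
have Sub : ubound S b by move=> y [/andP[]].
have supS : has_sup S by split; [exists a|exists b].
have as_ : a <= sup S by exact: (ub_le_sup (ex_intro _ b Sub)).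
have sb : sup S <= b by apply: ge_sup => //; exists a.
have [|d d0 hd] := hgood (sup S); first by rewrite as_.
have [x Sx ltx] := sup_adherent d0 supS.
have xs : x <= sup S by exact: (ub_le_sup (ex_intro _ b Sub)).
have [/andP[ax xb] [n [c [c0 cn ci]]]] := Sx.
(* One step from [x] to [y] straddles [sup S], so [y] is reachable; it would exceed the supremum
   unless the minimum is [b]. *)
pose y := Num.min b (sup S + d / 2).
have sy : sup S <= y by rewrite le_min sb lerDl divr_ge0// ltW.
have yb : y <= b by rewrite ge_min lexx.
have gxy : good x y.
  apply: hd => //; rewrite ?ax ?sy//.
  by rewrite gt_min ltrD2l ltr_pdivrMr// mulr_natr mulr2n ltrDl d0 orbT.
have Sy : S y.
  split; first by rewrite yb (le_trans as_ sy).
  exists n.+1, (fun i => if (i <= n)%N then c i else y); split.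
  - by rewrite leq0n.
  - by rewrite ltnn.
  - move=> i; rewrite ltnS => lein; rewrite lein.
    move: (lein); rewrite leq_eqVlt => /orP[/eqP ->|ltin].
      by rewrite ltnn cn; split => //; exact: le_trans xs sy.
    by rewrite ltin; exact: ci.
have ys : y <= sup S by exact: (ub_le_sup (ex_intro _ b Sub)).
have yE : y = b.
  move: ys; rewrite /y; case: (leP b (sup S + d / 2)) => // _.
  by rewrite gerDl leNgt divr_gt0.
by rewrite yE in Sy; case: Sy.
Qed.

Definition real_abs_continuous (R : realType) (a b : R) (f : R -> R) : Prop :=
  forall e : R, 0 < e -> exists2 d : R, 0 < d &
    forall (n : nat) (u v : 'I_n -> R),
      (forall i, [/\ a <= u i, u i <= v i & v i <= b]) ->
      trivIset [set: 'I_n] (fun i => `]u i, v i[%classic) ->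
      \sum_(i < n) (v i - u i) < d ->
      \sum_(i < n) `|f (v i) - f (u i)| < e.

Lemma lebesgue_measure_bigsetU_itvoo (R : realType) (n : nat)
    (u v : 'I_n -> R) :
  (forall i, u i <= v i) ->
  trivIset [set: 'I_n] (fun i => `]u i, v i[%classic) ->
  lebesgue_measure (\big[setU/set0]_(i < n) `]u i, v i[%classic : set R) =
  (\sum_(i < n) (v i - u i))%:E.
Proof.
move=> uv tI.
have -> : ((\sum_(i < n) (v i - u i))%:E =
    \sum_(i < n) lebesgue_measure (`]u i, v i[%classic : set R))%E.
  rewrite -sumEFin; apply: eq_bigr => i _; rewrite lebesgue_measure_itv/= lte_fin.
  by case: ltgtP (uv i) => // -> _; rewrite subrr.
by rewrite -(measure_bigsetU_ord _ xpredT).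
Qed.

Lemma sum_length_le_measure (R : realType) (U : set R) (n : nat)
    (u v : 'I_n -> R) :
  measurable U -> (forall i, u i <= v i) ->
  (forall i, `]u i, v i[%classic `<=` U) ->
  trivIset [set: 'I_n] (fun i => `]u i, v i[%classic) ->
  ((\sum_(i < n) (v i - u i))%:E <= lebesgue_measure U)%E.
Proof.
move=> mU uv sU tI; rewrite -lebesgue_measure_bigsetU_itvoo//.
apply: le_measure; rewrite ?inE//; first exact: bigsetU_measurable.
rewrite -bigcup_seq; apply: bigcup_sub => i _; exact: sU.
Qed.

Lemma trivIset_chain (R : realType) (n : nat) (x : nat -> R) :
  (forall i, (i < n)%N -> x i <= x i.+1) ->
  trivIset [set: 'I_n] (fun i => `]x i, x i.+1[%classic).
Proof.
move=> xle.
have mono i j : (i <= j)%N -> (j <= n)%N -> x i <= x j.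
  elim: j => [|j IH]; first by rewrite leqn0 => /eqP ->.
  rewrite leq_eqVlt => /orP[/eqP ->//|]; rewrite ltnS => ij jn.
  by rewrite (le_trans (IH ij (ltnW jn)))// xle.
apply/trivIsetP => i j _ _.
wlog ij : i j / (i < j)%N.
  move=> W neq; case: (ltngtP i j) => ij; first exact: W.
    by rewrite setIC; apply: W; rewrite // eq_sym.
  by move: neq; rewrite (ord_inj ij) eqxx.
move=> _; rewrite -subset0 => t [] /=; rewrite !in_itv/= => /andP[_ t1] /andP[t2 _].
have := lt_trans t2 t1; rewrite ltNge mono//.
exact: ltnW.
Qed.

(** Near [c] the difference quotients at [c] are below [e] on either side; the increments over
    [[u, c]] and [[c, v]] then add up. *)
Lemma is_derive_straddle (R : realType) (f : R -> R) (c l e : R) :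
  is_derive c 1 f l -> l < e -> exists2 d : R, 0 < d &
    forall u v, u <= c -> c <= v -> c - d < u -> v < c + d ->
    f v - f u <= e * (v - u).
Proof.
move=> [df <-] le_e.
have /cvgrPdist_lt/(_ (e - 'D_1 f c)) := df.
rewrite subr_gt0 => /(_ le_e) [/= d d0 hd].
exists d => // u v uc cv cdu vcd.
have slope y : y != c -> `|y - c| < d -> (y - c)^-1 * (f y - f c) < e.
  move=> yc ycd; have := hd (y - c); rewrite /= sub0r normrN ycd subr_eq0 yc.
  move=> /(_ isT isT); rewrite /GRing.scale/= mulr1 subrK -normrN.
  by move=> /(le_lt_trans (ler_norm _)); rewrite opprB ltrBlDr subrK.
have right_ : f v - f c <= e * (v - c).
  move: cv; rewrite le_eqVlt => /predU1P[->|cv]; first by rewrite !subrr mulr0.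
  have := slope v; rewrite gt_eqF// ger0_norm ?subr_ge0 ?(ltW cv)//.
  move=> /(_ isT); rewrite mulrC ltr_pdivrMr ?subr_gt0//.
  by move=> h; apply/ltW/h; rewrite ltrBlDl.
have left_ : f c - f u <= e * (c - u).
  move: uc; rewrite le_eqVlt => /predU1P[->|uc]; first by rewrite !subrr mulr0.
  have := slope u; rewrite lt_eqF// ltr0_norm ?subr_lt0// opprB.
  rewrite -mulrNN -invrN !opprB => /(_ isT).
  rewrite mulrC ltr_pdivrMr ?subr_gt0//.
  by move=> h; apply/ltW/h; rewrite ltrBlDl -ltrBlDr.
lra.
Qed.

(* The exceptional null set is covered by an open set U of length less than
   the modulus of absolute continuity: a fine chain splits into steps on which
   f has slope at most e, and steps inside U, which contribute at most e. *)
Lemma abs_continuous_le (R : realType) (a b : R) (f : R -> R) :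
  a <= b -> real_abs_continuous a b f ->
  {ae @lebesgue_measure R, forall t, a < t < b ->
     exists2 l : R, l <= 0 & is_derive t 1 f l} ->
  f b <= f a.
Proof.
move=> ab acf [A [mA A0 hA]].
(* Taken at [e / (b - a + 1)], the right-hand side collapses to [e]; the added 1 keeps the divisor
   positive when [a = b]. *)
suff key e : 0 < e -> f b - f a <= e * (b - a) + e.
  rewrite -subr_le0; apply/ler_addgt0Pr => e e0; rewrite add0r.
  have h0 : 0 < b - a + 1 by rewrite ltr_wpDl// subr_ge0.
  have := key (e / (b - a + 1)); rewrite divr_gt0// => /(_ isT)/le_trans; apply.
  by rewrite -[X in _ + X]mulr1 -mulrDr divfK// gt_eqF.
move=> e0; have [d d0 hd] := acf e e0.
(* The endpoints join the exceptional set because derivatives are assumed only inside the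
   interval. *)
pose A' := A `|` [set a; b].
have mab : measurable ([set a; b] : set R) by exact: measurableU.
have mA' : measurable A' by exact: measurableU.
have A'0 : lebesgue_measure A' = 0%E.
  by rewrite /A' !measureU0//; exact: lebesgue_measure_set1.
have [U [oU sU]] : exists U : set R, [/\ open U, A' `<=` U &
    (lebesgue_measure (U `\` A') < d%:E)%E].
  by apply: lebesgue_regularity_outer => //; move: A'0 => /= ->; rewrite ltry.
have mU : measurable U by exact: open_measurable.
have UA0 : lebesgue_measure (U `&` A') = 0%E.
  by apply: (subset_measure0 _ mA' _ A'0); [exact: measurableI|exact: subIsetr].
move=> UDd.
have Ud : (lebesgue_measure U < d%:E)%E.
  have /= -> := measureDI (@lebesgue_measure R) mU mA'.
  by move: UA0 => /= ->; rewrite adde0.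
pose slow u v := f v - f u <= e * (v - u).
pose inU u v := `]u, v[%classic `<=` U.
have [||n [x [x0 xn xi]]] := @cousin_chain R a b (fun u v => slow u v \/ inU u v).
- by [].
- move=> c /andP[ac cb].
  have [A'c|nA'c] := pselect (A' c).
    have /open_nbhs_nbhs/nbhs_ballP[r r0 hr] : open_nbhs c U.
      by split => //; exact: sU.
    exists r => // u v /andP[au uc] /andP[cv vb] cru vcr; right => t.
    rewrite /= in_itv/= => /andP[ut tv]; apply: hr.
    by rewrite /ball/= ltr_distlC; apply/andP; split; lra.
  have [l l0 dl] : exists2 l : R, l <= 0 & is_derive c 1 f l.
    apply: contrapT => nl; apply: nA'c.
    have [->|ca] := eqVneq c a; first by right; left.
    have [->|cb'] := eqVneq c b; first by right; right.
    left; apply: hA => /=; apply: contra_not nl; apply.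
    by rewrite !lt_neqAle ac cb eq_sym ca cb'.
  have [r r0 hr] := is_derive_straddle dl (le_lt_trans l0 e0).
  by exists r => // u v /andP[_ uc] /andP[cv _] ? ?; left; exact: hr.
have xle i : (i < n)%N -> x i <= x i.+1 by move=> /xi[].
have xge i : (i <= n)%N -> a <= x i.
  elim: i => [|i IH] lin; first by rewrite x0.
  by rewrite (le_trans (IH (ltnW lin)))// xle.
have xleb i : (i <= n)%N -> x i <= b.
  move=> lin; rewrite -(subKn lin).
  elim: (n - i)%N (leq_subr i n) => [|j IH] jn; first by rewrite subn0 xn.
  by rewrite (le_trans _ (IH (ltnW jn)))// -(subnSK jn) xle// subnSK// leq_subr.
(* Slow steps collapse to empty intervals, so the family stays indexed by all steps while its union
   lies in [U]. *)
pose v (i : 'I_n) := if `[< slow (x i) (x i.+1) >] then x i else x i.+1.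
have uv (i : 'I_n) : x i <= v i by rewrite /v; case: ifP => // _; exact: xle.
have svx (i : 'I_n) : `]x i, v i[%classic `<=` `]x i, x i.+1[%classic.
  rewrite /v; case: ifP => _ //; rewrite set_itvoo0; exact: sub0set.
have tI : trivIset [set: 'I_n] (fun i => `]x i, v i[%classic).
  apply/trivIsetP => j k _ _ jk.
  have /trivIsetP/(_ j k I I jk) := trivIset_chain xle.
  by apply: subsetI_eq0; exact: svx.
have sU' (i : 'I_n) : `]x i, v i[%classic `<=` U.
  rewrite /v; case: asboolP => [_|nslow].
    by rewrite set_itvoo0.
  by have [_ []] := xi i (ltn_ord i).
have sumd : \sum_(i < n) (v i - x i) < d.
  rewrite -lte_fin; apply: le_lt_trans Ud.
  exact: sum_length_le_measure.
have := hd n x v.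
have -> : f b - f a = \sum_(i < n) (f (x i.+1) - f (x i)).
  rewrite -x0 -xn -(big_mkord xpredT (fun i => f (x i.+1) - f (x i))).
  by rewrite telescope_sumr.
have -> : b - a = \sum_(i < n) (x i.+1 - x i).
  rewrite -x0 -xn -(big_mkord xpredT (fun i => (x i.+1) - (x i))).
  by rewrite telescope_sumr.
move=> /(_ _ tI sumd) hsum.
have {}hsum : \sum_(i < n) `|f (v i) - f (x i)| <= e.
  apply/ltW/hsum => i; split; [exact/xge/ltnW|exact: uv|].
  by rewrite /v; case: ifP => _; apply: xleb => //; exact: ltnW.
(* Term by term, a slow step is paid for by [e] times its length and any other step by its absolute
   increment. *)
rewrite mulr_sumr; apply: le_trans (lerD (lexx _) hsum).
rewrite -big_split/=; apply: ler_sum => i _; rewrite /v.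
case: asboolP => [sl|_]; first by rewrite subrr normr0 addr0.
have ei : 0 <= e * (x i.+1 - x i).
  by rewrite mulr_ge0 ?(ltW e0)// subr_ge0 xle.
have := ler_norm (f (x i.+1) - f (x i)); lra.
Qed.

(** * Primitives of real functions *)

Lemma real_abs_continuous_within (R : realType) (a b : R) (f : R -> R) :
  real_abs_continuous a b f -> {within `[a, b], continuous f}.
Proof.
move=> acf; apply/subspace_continuousP => x; rewrite /= in_itv/= => /andP[ax xb].
apply/cvgrPdist_lt => e e0; have [d d0 hd] := acf e e0.
rewrite near_withinE; near=> y => /=; rewrite in_itv/= => /andP[ay yb].
(* A family of one interval; the minimum and maximum treat both orders of [x] and [y] at once. *)
have := hd 1%N (fun=> Num.min x y) (fun=> Num.max x y).
rewrite !big_ord1 => H.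
have xy : `|x - y| < d by near: y; exact: cvgr_dist_lt.
suff : `|f (Num.max x y) - f (Num.min x y)| < e.
  by case: (leP x y) => _ //; rewrite distrC.
apply: H.
- move=> _; rewrite le_min ge_max ax ay xb yb le_max ge_min; split => //.
  by rewrite !ge_min !lexx !orbT.
- by apply/trivIsetP => i j _ _; rewrite !ord1 eqxx.
- move: xy; case: (leP x y) => [xy|/ltW xy]; first rewrite distrC.
    by rewrite ger0_norm ?subr_ge0.
  by rewrite ger0_norm ?subr_ge0.
Unshelve. all: by end_near. Qed.

Lemma real_abs_continuous_bounded (R : realType) (a b : R) (f : R -> R) :
  a <= b -> real_abs_continuous a b f ->
  exists2 C : R, 0 < C & forall t, a <= t <= b -> `|f t| <= C.
Proof.
move=> ab /real_abs_continuous_within cf.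
have [c _ hc] := EVT_max ab cf; have [c' _ hc'] := EVT_min ab cf.
(* The 1 makes the bound positive, so that the product rule for absolute continuity can divide by
   it. *)
exists (1 + `|f c| + `|f c'|) => [|t tab].
  by rewrite -addrA ltr_pwDl// addr_ge0.
have := hc t tab; have := hc' t tab.
have := ler_norm (f c); have := ler_norm (- f c'); rewrite normrN.
have := normr_ge0 (f c); have := normr_ge0 (f c').
rewrite ler_norml; lra.
Qed.

(** * Closure properties of absolute continuity *)

Section abs_continuous_closure.
Variables (R : realType) (a b : R).
Implicit Types f g : R -> R.
Local Notation AC := (real_abs_continuous a b).

Lemma real_abs_continuous_cst (c : R) : AC (fun=> c).
Proof.
move=> e e0; exists 1 => // n u v _ _ _.
by rewrite big1// => i _; rewrite subrr normr0.
Qed.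

Lemma real_abs_continuous_lipschitz f (C : R) :
  (forall u v, a <= u -> u <= v -> v <= b -> `|f v - f u| <= C * (v - u)) ->
  AC f.
Proof.
move=> fC e e0; have C0 : 0 < `|C| + 1 by rewrite ltr_wpDl.
exists (e / (`|C| + 1)); first exact: divr_gt0.
move=> n u v uv _; rewrite ltr_pdivlMr// => /(le_lt_trans _); apply.
rewrite mulr_suml; apply: ler_sum => i _; have [au vu vb] := uv i.
rewrite (le_trans (fC _ _ au vu vb))// mulrC ler_wpM2l ?subr_ge0//.
by rewrite (le_trans (ler_norm C))// lerDl.
Qed.

Lemma real_abs_continuousD f g : AC f -> AC g -> AC (fun t => f t + g t).
Proof.
move=> acf acg e e0; have e20 : 0 < e / 2 by rewrite divr_gt0.
have [d1 d10 h1] := acf _ e20; have [d2 d20 h2] := acg _ e20.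
exists (Num.min d1 d2); first by rewrite lt_min d10.
move=> n u v uv tI; rewrite lt_min => /andP[s1 s2].
have := ltrD (h1 n u v uv tI s1) (h2 n u v uv tI s2).
rewrite -splitr -big_split/=; apply: le_lt_trans; apply: ler_sum => i _.
by rewrite (le_trans _ (ler_normD _ _))// opprD addrACA.
Qed.

Lemma real_abs_continuousM f g :
  a <= b -> AC f -> AC g -> AC (fun t => f t * g t).
Proof.
move=> ab acf acg e e0.
have [C C0 fC] := real_abs_continuous_bounded ab acf.
have [D D0 gD] := real_abs_continuous_bounded ab acg.
have [d1 d10 h1] := acf (e / 2 / D) ltac:(by rewrite !divr_gt0).
have [d2 d20 h2] := acg (e / 2 / C) ltac:(by rewrite !divr_gt0).
exists (Num.min d1 d2); first by rewrite lt_min d10.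
move=> n u v uv tI; rewrite lt_min => /andP[s1 s2].
have := h1 n u v uv tI s1; rewrite ltr_pdivlMr// => {}h1.
have := h2 n u v uv tI s2; rewrite ltr_pdivlMr// => {}h2.
have := ltrD h1 h2.
rewrite -splitr !mulr_suml -big_split/=; apply: le_lt_trans.
apply: ler_sum => i _; have [au vu vb] := uv i.
have -> : f (v i) * g (v i) - f (u i) * g (u i) =
  (f (v i) - f (u i)) * g (u i) + (g (v i) - g (u i)) * f (v i) by ring.
rewrite (le_trans (ler_normD _ _))// !normrM lerD// ler_wpM2l//.
- by rewrite gD// au (le_trans vu).
- by rewrite fC// vb (le_trans au).
Qed.

End abs_continuous_closure.

(** This relation stands in for the Lebesgue integral: [f t - f s] plays the role of the integral of
    [f'] from [s] to [t]. *)
Definition primitive (R : realType) (T : R) (f f' : R -> R) : Prop :=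
  real_abs_continuous 0 T f /\
  {ae @lebesgue_measure R, forall t, 0 < t < T -> is_derive t 1 f (f' t)}.

Section primitive.
Variables (R : realType) (T : R).
Implicit Types f g : R -> R.

(** Applied to a difference of primitives, this compares the integrals of two ordered integrands. *)
Lemma primitive_le f f' s t : primitive T f f' ->
  (forall r, 0 < r < T -> f' r <= 0) -> 0 <= s -> s <= t -> t <= T ->
  f t <= f s.
Proof.
move=> [acf df] f'0 s0 st tT; apply: abs_continuous_le => //.
  move=> e e0; have [d d0 hd] := acf e e0; exists d => // n u v uv.
  apply: hd => i; have [su vu vt] := uv i.
  by rewrite (le_trans s0 su) (le_trans vt tT).
apply: (@filterS _ _ (ae_filter_ringOfSetsType _) _ _ _ df) => r dr /andP[sr rt].
have r0T : 0 < r < T by rewrite (le_lt_trans s0)// (lt_le_trans rt).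
by exists (f' r); [exact: f'0|exact: dr].
Qed.

Lemma primitive_within f f' : primitive T f f' -> {within `[0, T], continuous f}.
Proof. by move=> [/real_abs_continuous_within]. Qed.

Lemma primitive_congr f f' g g' :
  f =1 g -> f' =1 g' -> primitive T f f' -> primitive T g g'.
Proof. by move=> /funext -> /funext ->. Qed.

Lemma primitive_cst (c : R) : primitive T (fun=> c) (fun=> 0).
Proof.
split; first exact: real_abs_continuous_cst.
by apply: aeW => t _; exact: is_derive_cst.
Qed.

Lemma primitiveD f f' g g' : primitive T f f' -> primitive T g g' ->
  primitive T (fun t => f t + g t) (fun t => f' t + g' t).
Proof.
move=> [acf df] [acg dg]; split; first exact: real_abs_continuousD.
apply: (@filterS2 _ _ (ae_filter_ringOfSetsType _) _ _ _ _ df dg) => t dft dgt tT.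
by apply: is_deriveD; [exact: dft|exact: dgt].
Qed.

Lemma primitiveM f f' g g' : 0 <= T -> primitive T f f' -> primitive T g g' ->
  primitive T (fun t => f t * g t) (fun t => f' t * g t + f t * g' t).
Proof.
move=> T0 [acf df] [acg dg]; split; first exact: real_abs_continuousM.
apply: (@filterS2 _ _ (ae_filter_ringOfSetsType _) _ _ _ _ df dg) => t dft dgt tT.
apply: is_derive_eq; first by apply: is_deriveM; [exact: dft|exact: dgt].
by rewrite /GRing.scale/= addrC mulrC.
Qed.

Lemma primitiveZ (c : R) f f' : 0 <= T -> primitive T f f' ->
  primitive T (fun t => c * f t) (fun t => c * f' t).
Proof.
move=> T0 pf.
apply: primitive_congr (primitiveM T0 (primitive_cst c) pf) => // t.
by rewrite mul0r add0r.
Qed.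

Lemma primitiveN f f' : 0 <= T -> primitive T f f' ->
  primitive T (fun t => - f t) (fun t => - f' t).
Proof.
move=> T0 /(primitiveZ (-1) T0).
by apply: primitive_congr => t; rewrite mulN1r.
Qed.

Lemma primitive_sum (I : Type) (s : seq I) (f f' : I -> R -> R) :
  (forall i, primitive T (f i) (f' i)) ->
  primitive T (fun t => \sum_(i <- s) f i t) (fun t => \sum_(i <- s) f' i t).
Proof.
move=> pf; elim: s => [|i s IH].
  by apply: primitive_congr (primitive_cst 0) => t; rewrite big_nil.
by apply: primitive_congr (primitiveD (pf i) IH) => t; rewrite big_cons.
Qed.

(** By the mean value theorem [f] is Lipschitz on [[0, T]], hence absolutely continuous. *)
Lemma primitive_smooth f f' (C : R) : (forall t : R, is_derive t 1 f (f' t)) ->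
  (forall t, 0 <= t <= T -> `|f' t| <= C) -> primitive T f f'.
Proof.
move=> df f'C; split; last by apply: aeW => t _.
apply: (@real_abs_continuous_lipschitz _ _ _ _ C) => u v u0 uv vT.
have cf : {within `[u, v], continuous f}.
  by apply: derivable_within_continuous => x _; exact: (@ex_derive _ _ _ _ _ _ _ (df x)).
have [c] := MVT_segment uv (fun x _ => df x) cf.
rewrite in_itv/= => /andP[uc cv] ->.
rewrite normrM [`|v - u|]ger0_norm ?subr_ge0// ler_wpM2r ?subr_ge0// f'C//.
by rewrite (le_trans u0 uc) (le_trans cv vT).
Qed.

End primitive.

Local Notation mu := (@lebesgue_measure _).

(** Absolute continuity of the indefinite integral comes from that of the integral as a set
    function, and the derivative from Lebesgue differentiation. *)
Lemma primitive_exists (R : realType) (T : R) (g : R -> R) :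
  (@lebesgue_measure R).-integrable `[0, T] (EFin \o g) ->
  exists G : R -> R, primitive T G g /\ G 0 = 0.
Proof.
move=> ig.
(* Extension by zero gives a function integrable on the whole line, so that the integral from minus
   infinity is defined; subtracting [F 0] normalises it. *)
pose h := g \_ `[0, T].
have ih : mu.-integrable [set: R] (EFin \o h).
  rewrite -restrict_EFin.
  have [] := @integrable_mkcond _ _ _ mu _ (EFin \o g) (measurable_itv `[0%R, T]).
  by move=> + _; exact.
have ihD D : measurable D -> mu.-integrable D (EFin \o h).
  by move=> mD; exact: integrableS ih.
pose F x := (\int[mu]_(t in `]-oo, x]) h t)%R.
exists (fun x => F x - F 0); split; last by rewrite subrr.
split.
  move=> e e0; have [d [d0 hd]] := integral_normr_continuous ih e0.
  exists d => // n u v uv tI sd.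
  pose D : set R := \big[setU/set0]_(i < n) `]u i, v i[%classic.
  have mD : measurable D by exact: bigsetU_measurable.
  have muD : (mu D < d%:E)%E.
    by rewrite lebesgue_measure_bigsetU_itvoo ?lte_fin// => i; have [] := uv i.
  have := hd D mD muD; apply: le_lt_trans.
  have ihn A : measurable A -> mu.-integrable A (EFin \o (fun t => `|h t|)).
    by move=> mA; exact: (integrable_norm (ihD A mA)).
  have -> : \int[mu]_(x in D) `|h x| =
      \sum_(i < n) \int[mu]_(x in `]u i, v i[) `|h x|.
    rewrite /Rintegral /D integral_bigsetU_EFin//=.
    - rewrite -sum_fine// => i _.
      exact: integrable_fin_num (ihn _ _).
    - exact: index_enum_uniq.
    - by apply: sub_trivIset tI.
    - by case/integrableP: (ihn D mD).
  apply: ler_sum => i _; have [au uvi vb] := uv i.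
  rewrite opprB addrA subrK /F Rintegral_itvB ?bnd_simp//; last exact: ihD.
  rewrite -Rintegral_itv_bndo_bndc; last exact: ihD.
  by apply: le_normr_Rintegral => //; exact: ihD.
have := FTC1Ny (fun y => ihD _ (measurable_itv `]-oo, y]))
  (open_integrable_locally openT ih).
apply: (@filterS _ _ (ae_filter_ringOfSetsType _)) => t [dF Ft] /andP[t0 tT].
have dFt : is_derive t 1 F (g t).
  apply: DeriveDef; first exact: dF.
  rewrite -derive1E -/F Ft /h patchE ifT//.
  by rewrite inE/= in_itv/= !ltW.
by apply: is_derive_eq; rewrite subr0.
Qed.

(** The squared modulus, kept as a polynomial in the components so that [ring] and [lra] apply. *)
Definition norm2 (R : realType) (z : R[i]) : R :=
  complex.Re z ^+ 2 + complex.Im z ^+ 2.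

Lemma modulus_sqr (R : realType) (z : R[i]) : modulus z ^+ 2 = norm2 z.
Proof.
by rewrite /modulus normc_def /= sqr_sqrtr// addr_ge0// sqr_ge0.
Qed.

Lemma norm2_ge0 (R : realType) (z : R[i]) : 0 <= norm2 z.
Proof. by rewrite addr_ge0// sqr_ge0. Qed.

Section in_L2.
Variables (R : realType) (T : R) (q : R -> R[i]).
Hypothesis qL2 : in_L2 T q.

Lemma measurable_norm2 : measurable_fun `[0, T] (fun t => norm2 (q t)).
Proof.
have [mRe mIm _] := qL2.
by apply: measurable_funD; exact: measurable_realfun.measurable_funX.
Qed.

(** The dominating function is integrable because the interval is bounded and [q] is
    square-integrable. One domination covers the components of [q] times an exponential, [norm2] of
    [q], and bounded functions. *)
Lemma in_L2_primitive (g : R -> R) (C : R) :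
  measurable_fun `[0, T] g ->
  (forall t, 0 <= t <= T -> `|g t| <= C * (1 + norm2 (q t))) ->
  exists G : R -> R, primitive T G g /\ G 0 = 0.
Proof.
move=> mg gC; apply: primitive_exists.
have mI : measurable (`[0, T] : set R) by [].
have fI : (lebesgue_measure (`[0%R, T]%classic : set R) < +oo)%E.
  by rewrite lebesgue_measure_itv/=; case: ifP => _; rewrite ?ltry.
have i1 : (@lebesgue_measure R).-integrable `[0, T] (EFin \o cst 1).
  apply: measurable_bounded_integrable => //.
  exact: bounded_cst.
have i2 : (@lebesgue_measure R).-integrable `[0, T] (EFin \o (fun t => norm2 (q t))).
  apply/integrableP; split; first by apply/measurable_EFinP; exact: measurable_norm2.
  have [_ _] := qL2; apply: le_lt_trans.
  rewrite le_eqVlt; apply/orP; left; apply/eqP; apply: eq_integral => t _ /=.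
  by rewrite modulus_sqr ger0_norm// norm2_ge0.
have i3 : (@lebesgue_measure R).-integrable `[0, T]
    (fun t => C%:E * (1 + (norm2 (q t))%:E))%E.
  by apply: integrableZl => //; apply: (integrableD _ i1 i2).
apply: (le_integrable _ _ _ i3) => //; first exact/measurable_EFinP.
move=> t; rewrite /= in_itv/= => tT; rewrite lee_fin.
exact: le_trans (gC t tT) (ler_norm _).
Qed.

End in_L2.

(** * Complex-valued primitives *)

Lemma is_derive_scale_arg (R : realType) (f : R -> R) (c t l : R) :
  is_derive (c * t) 1 f l -> is_derive t 1 (fun s => f (c * s)) (c * l).
Proof.
move=> df; have dc : is_derive t 1 (fun s => c * s) c.
  by apply: is_derive_eq; rewrite /GRing.scale/= mulr1.
by rewrite mulrC; exact: is_derive1_comp.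
Qed.

Section complex_components.
Variable R : realType.
Implicit Types x y : R[i].

Lemma ReD x y : complex.Re (x + y) = complex.Re x + complex.Re y.
Proof. by case: x; case: y. Qed.

Lemma ImD x y : complex.Im (x + y) = complex.Im x + complex.Im y.
Proof. by case: x; case: y. Qed.

Lemma ReN x : complex.Re (- x) = - complex.Re x.
Proof. by case: x. Qed.

Lemma ImN x : complex.Im (- x) = - complex.Im x.
Proof. by case: x. Qed.

Lemma ReM x y :
  complex.Re (x * y) = complex.Re x * complex.Re y - complex.Im x * complex.Im y.
Proof. by case: x; case: y. Qed.

Lemma ImM x y :
  complex.Im (x * y) = complex.Re x * complex.Im y + complex.Im x * complex.Re y.
Proof. by case: x; case: y => *; rewrite /= addrC. Qed.

Lemma Re_conj x : complex.Re (conjc x) = complex.Re x.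
Proof. by case: x. Qed.

Lemma Im_conj x : complex.Im (conjc x) = - complex.Im x.
Proof. by case: x. Qed.

Lemma conjcM x y : conjc (x * y) = conjc x * conjc y.
Proof. exact: rmorphM. Qed.

Lemma conjc_sum (I : Type) (s : seq I) (F : I -> R[i]) :
  conjc (\sum_(i <- s) F i) = \sum_(i <- s) conjc (F i).
Proof. exact: raddf_sum. Qed.

Definition complexRI := (ReD, ImD, ReN, ImN, ReM, ImM, Re_conj, Im_conj).

Lemma complex_eq x y :
  complex.Re x = complex.Re y -> complex.Im x = complex.Im y -> x = y.
Proof. by case: x; case: y => /= ? ? ? ? -> ->. Qed.

Lemma Re_sum (I : Type) (s : seq I) (F : I -> R[i]) :
  complex.Re (\sum_(i <- s) F i) = \sum_(i <- s) complex.Re (F i).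
Proof. by elim: s => [|i s IH]; rewrite ?big_nil// !big_cons ReD IH. Qed.

Lemma Im_sum (I : Type) (s : seq I) (F : I -> R[i]) :
  complex.Im (\sum_(i <- s) F i) = \sum_(i <- s) complex.Im (F i).
Proof. by elim: s => [|i s IH]; rewrite ?big_nil// !big_cons ImD IH. Qed.

Lemma norm2M x y : norm2 (x * y) = norm2 x * norm2 y.
Proof. by rewrite /norm2 !complexRI; ring. Qed.

Lemma norm2_conj x : norm2 (conjc x) = norm2 x.
Proof. by rewrite /norm2 !complexRI sqrrN. Qed.

Lemma norm2D_le x y : norm2 (x + y) <= 2 * norm2 x + 2 * norm2 y.
Proof.
rewrite /norm2 !complexRI -subr_ge0.
have -> : 2 * (complex.Re x ^+ 2 + complex.Im x ^+ 2) +
  2 * (complex.Re y ^+ 2 + complex.Im y ^+ 2) -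
  ((complex.Re x + complex.Re y) ^+ 2 + (complex.Im x + complex.Im y) ^+ 2) =
  (complex.Re x - complex.Re y) ^+ 2 + (complex.Im x - complex.Im y) ^+ 2 by ring.
by rewrite addr_ge0// sqr_ge0.
Qed.

Lemma mulr_conj x : x * conjc x = (norm2 x)%:C.
Proof. by apply: complex_eq; rewrite !complexRI/= /norm2; ring. Qed.

(** Young's inequality: the difference of the two sides is a sum of two squares over [2 * e]. The
    weight [e] is chosen at each use so that one term can be absorbed. *)
Lemma Re_mul_le (e : R) x y : 0 < e ->
  complex.Re (x * y) <= (e * norm2 x + norm2 y / e) / 2.
Proof.
move=> e0; rewrite ReM /norm2 -subr_ge0.
set a := complex.Re x; set b := complex.Im x.
set c := complex.Re y; set d := complex.Im y.
have -> : (e * (a ^+ 2 + b ^+ 2) + (c ^+ 2 + d ^+ 2) / e) / 2 - (a * c - b * d) =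
  ((e * a - c) ^+ 2 + (e * b + d) ^+ 2) / (2 * e) by field; rewrite gt_eqF.
by rewrite divr_ge0 ?mulr_ge0 ?addr_ge0 ?sqr_ge0 ?(ltW e0).
Qed.

Lemma Re_le_modulus x : `|complex.Re x| <= modulus x.
Proof.
by rewrite /modulus normc_def/= -sqrtr_sqr ler_wsqrtr// lerDl sqr_ge0.
Qed.

Lemma Im_le_modulus x : `|complex.Im x| <= modulus x.
Proof.
by rewrite /modulus normc_def/= -sqrtr_sqr ler_wsqrtr// lerDr sqr_ge0.
Qed.

Definition expi (x : R) : R[i] := cos x +i* sin x.

Lemma expi0 : expi 0 = 1.
Proof. by rewrite /expi cos0 sin0. Qed.

Lemma expiD (s t : R) : expi (s + t) = expi s * expi t.
Proof. by apply: complex_eq; rewrite !complexRI /expi/= ?cosD ?sinD; ring. Qed.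

Lemma conj_expi (t : R) : conjc (expi t) = expi (- t).
Proof. by rewrite /expi/= cosN sinN. Qed.

Lemma norm2_expi (t : R) : norm2 (expi t) = 1.
Proof. by rewrite /norm2/= cos2Dsin2. Qed.

Lemma expi_2piz (k : int) : expi (2 * pi * k%:~R) = 1.
Proof.
have E (n : nat) : expi (2 * pi * n%:R) = 1.
  elim: n => [|n IH]; first by rewrite mulr0 expi0.
  rewrite -(natr1 n) mulrDr mulr1 expiD IH mul1r /expi mulr_natl.
  by rewrite cos2pi sin2pi.
case: k => n; first exact: E.
by rewrite NegzE mulrNz mulrN -conj_expi E; apply: complex_eq => //=; rewrite oppr0.
Qed.

End complex_components.

Definition cprimitive (R : realType) (T : R) (f f' : R -> R[i]) : Prop :=
  primitive T (fun t => complex.Re (f t)) (fun t => complex.Re (f' t)) /\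
  primitive T (fun t => complex.Im (f t)) (fun t => complex.Im (f' t)).

Section cprimitive.
Variables (R : realType) (T : R).
Hypothesis T0 : 0 <= T.
Implicit Types f g : R -> R[i].

Lemma cprimitive_congr f f' g g' :
  f =1 g -> f' =1 g' -> cprimitive T f f' -> cprimitive T g g'.
Proof. by move=> /funext -> /funext ->. Qed.

Lemma cprimitive_cst (c : R[i]) : cprimitive T (fun=> c) (fun=> 0).
Proof. by split; exact: primitive_cst. Qed.

Lemma cprimitiveD f f' g g' : cprimitive T f f' -> cprimitive T g g' ->
  cprimitive T (fun t => f t + g t) (fun t => f' t + g' t).
Proof.
move=> [f1 f2] [g1 g2]; split.
- by apply: primitive_congr (primitiveD f1 g1) => t; rewrite ReD.
- by apply: primitive_congr (primitiveD f2 g2) => t; rewrite ImD.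
Qed.

Lemma cprimitiveN f f' : cprimitive T f f' ->
  cprimitive T (fun t => - f t) (fun t => - f' t).
Proof.
move=> [f1 f2]; split.
- by apply: primitive_congr (primitiveN T0 f1) => t; rewrite ReN.
- by apply: primitive_congr (primitiveN T0 f2) => t; rewrite ImN.
Qed.

Lemma cprimitive_conj f f' : cprimitive T f f' ->
  cprimitive T (fun t => conjc (f t)) (fun t => conjc (f' t)).
Proof.
move=> [f1 f2]; split.
- by apply: primitive_congr f1 => t; rewrite Re_conj.
- by apply: primitive_congr (primitiveN T0 f2) => t; rewrite Im_conj.
Qed.

Lemma cprimitiveM f f' g g' : cprimitive T f f' -> cprimitive T g g' ->
  cprimitive T (fun t => f t * g t) (fun t => f' t * g t + f t * g' t).
Proof.
move=> [f1 f2] [g1 g2]; split.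
- apply: primitive_congr (primitiveD (primitiveM T0 f1 g1)
    (primitiveN T0 (primitiveM T0 f2 g2))) => t; rewrite !complexRI; ring.
- apply: primitive_congr (primitiveD (primitiveM T0 f1 g2)
    (primitiveM T0 f2 g1)) => t; rewrite !complexRI; ring.
Qed.

Lemma cprimitiveZ (c : R[i]) f f' : cprimitive T f f' ->
  cprimitive T (fun t => c * f t) (fun t => c * f' t).
Proof.
move=> /(cprimitiveM (cprimitive_cst c)).
by apply: cprimitive_congr => // t; rewrite mul0r add0r.
Qed.

Lemma cprimitive_sum (I : Type) (s : seq I) (f f' : I -> R -> R[i]) :
  (forall i, cprimitive T (f i) (f' i)) ->
  cprimitive T (fun t => \sum_(i <- s) f i t) (fun t => \sum_(i <- s) f' i t).
Proof.
move=> pf; split.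
- apply: primitive_congr (primitive_sum s (fun i => (pf i).1)) => t;
  by rewrite Re_sum.
- apply: primitive_congr (primitive_sum s (fun i => (pf i).2)) => t;
  by rewrite Im_sum.
Qed.

Lemma primitive_norm2 f f' : cprimitive T f f' ->
  primitive T (fun t => norm2 (f t)) (fun t => 2 * complex.Re (conjc (f t) * f' t)).
Proof.
move=> [f1 f2].
apply: primitive_congr (primitiveD (primitiveM T0 f1 f1) (primitiveM T0 f2 f2)) => t.
  by rewrite /norm2 !expr2.
by rewrite !complexRI; ring.
Qed.

(** Entry point for the Caratheodory solution: increments of the components are bounded by the
    modulus of the increment. *)
Lemma abs_continuous_cprimitive f f' : abs_continuous 0 T f ->
  {ae @lebesgue_measure R, forall t, 0 < t < T -> has_cderive f t (f' t)} ->
  cprimitive T f f'.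
Proof.
move=> acf df; split; split.
- move=> e /acf[d d0 hd]; exists d => // n u v uv tI /(hd n u v uv tI).
  by apply: le_lt_trans; apply: ler_sum => i _; rewrite -ReN -ReD Re_le_modulus.
- apply: (@filterS _ _ (ae_filter_ringOfSetsType _) _ _ _ df) => t dft tT.
  exact: (dft tT).1.
- move=> e /acf[d d0 hd]; exists d => // n u v uv tI /(hd n u v uv tI).
  by apply: le_lt_trans; apply: ler_sum => i _; rewrite -ImN -ImD Im_le_modulus.
- apply: (@filterS _ _ (ae_filter_ringOfSetsType _) _ _ _ df) => t dft tT.
  exact: (dft tT).2.
Qed.

Lemma cprimitive_expi (nu : R) :
  cprimitive T (fun t => expi (nu * t)) (fun t => (0 +i* nu) * expi (nu * t)).
Proof.
split.
- apply: (@primitive_smooth _ _ _ _ `|nu|) => [t|t _].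
    apply: is_derive_eq; first exact: (is_derive_scale_arg (is_derive_cos _)).
    by rewrite !complexRI/=; ring.
  rewrite !complexRI/= mul0r sub0r normrN normrM ler_piMr// ler_norml.
  by rewrite sin_geN1 sin_le1.
- apply: (@primitive_smooth _ _ _ _ `|nu|) => [t|t _].
    apply: is_derive_eq; first exact: (is_derive_scale_arg (is_derive_sin _)).
    by rewrite !complexRI/=; ring.
  rewrite !complexRI/= mul0r add0r normrM ler_piMr// ler_norml.
  by rewrite cos_geN1 cos_le1.
Qed.

End cprimitive.

(** * Bessel's inequality for truncated Fourier coefficients *)

Section bessel.
Variables (R : realType) (T : R).
Hypothesis T_gt0 : 0 < T.
Let T_ge0 : 0 <= T := ltW T_gt0.

(** The real number whose embedding into [R[i]] is [free_zero T k]. *)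
Definition frequency (k : int) : R := 2 * pi / T * k%:~R.

Definition half : R[i] := (2^-1 : R)%:C.

Lemma norm2_half : norm2 half = 4^-1.
Proof. by rewrite /norm2/= expr0n addr0 expr2 -invfM -natrM. Qed.

Lemma frequency_inj : injective frequency.
Proof.
move=> k l /mulfI kl; apply/eqP; rewrite -(eqr_int R); apply/eqP/kl.
by rewrite !mulf_neq0// ?invr_eq0 gt_eqF// pi_gt0.
Qed.

(** An antiderivative of [expi (nu * t)]; the frequency 0 is separate because the factor [nu^-1],
    standing for division by i nu, is 0 there by convention. *)
Definition expi_primitive (nu t : R) : R[i] :=
  if nu == 0 then t%:C else (0 -i* nu^-1) * expi (nu * t).

Lemma expi_primitiveP (nu : R) :
  cprimitive T (expi_primitive nu) (fun t => expi (nu * t)).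
Proof.
rewrite /expi_primitive; have [->|nu0] := eqVneq nu 0.
  apply: (@cprimitive_congr _ _ (fun t => t%:C) (fun=> 1)) => // [t|].
    by rewrite mul0r expi0.
  split; last exact: primitive_cst.
  by apply: (@primitive_smooth _ _ _ _ 1) => // t; rewrite normr1.
apply: cprimitive_congr (cprimitiveZ T_ge0 (0 -i* nu^-1) (cprimitive_expi T nu)) => // t.
rewrite mulrA; set c := (X in X * _); suff -> : c = 1 by rewrite mul1r.
by apply: complex_eq; rewrite /c !complexRI/=; field.
Qed.

(** Orthogonality of the exponentials over a full period: the phase at [T] is an integer multiple of
    2 pi, so for distinct frequencies both endpoint values agree. *)
Lemma expi_primitive_period (k l : int) :
  expi_primitive (frequency k - frequency l) T -
  expi_primitive (frequency k - frequency l) 0 = if k == l then T%:C else 0.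
Proof.
rewrite /expi_primitive subr_eq0 (inj_eq frequency_inj).
case: eqP => _; first by rewrite subr0.
rewrite (_ : (frequency k - frequency l) * T = 2 * pi * (k - l)%:~R); last first.
  by rewrite /frequency rmorphB/=; field; rewrite gt_eqF.
by rewrite expi_2piz mulr0 expi0 subrr.
Qed.

(** Parseval's identity for a trigonometric polynomial: the squared modulus expands into a double
    sum, and orthogonality leaves only its diagonal. *)
Lemma trigonometric_norm2 (s : seq int) (a : int -> R[i]) : uniq s ->
  exists S : R -> R,
    primitive T S (fun t => norm2 (\sum_(k <- s) a k * expi (frequency k * t))) /\
    S T - S 0 = T * \sum_(k <- s) norm2 (a k).
Proof.
move=> us.
pose A (k l : int) := expi_primitive (frequency k - frequency l).
pose S t := \sum_(k <- s) \sum_(l <- s) a k * conjc (a l) * A k l t.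
have pS : cprimitive T S (fun t => \sum_(k <- s) \sum_(l <- s)
    a k * conjc (a l) * expi ((frequency k - frequency l) * t)).
  apply: cprimitive_sum => k; apply: cprimitive_sum => l.
  exact: (cprimitiveZ T_ge0 _ (expi_primitiveP _)).
exists (fun t => complex.Re (S t)); split.
  apply: primitive_congr pS.1 => // t.
  rewrite -[RHS]/(complex.Re (norm2 _)%:C) -mulr_conj; congr complex.Re.
  rewrite mulr_suml; apply: eq_bigr => k _.
  rewrite conjc_sum mulr_sumr; apply: eq_bigr => l _.
  by rewrite conjcM mulrBl expiD -conj_expi; ring.
rewrite -ReN -ReD /S -sumrB (eq_big_seq (fun k => (T * norm2 (a k))%:C)).
  by rewrite Re_sum mulr_sumr.
move=> k ks; rewrite -sumrB (bigD1_seq k)//= big1 ?addr0.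
  by rewrite -mulrBr expi_primitive_period eqxx mulr_conj -rmorphM mulrC.
by move=> l lk; rewrite -mulrBr expi_primitive_period eq_sym (negPf lk) mulr0.
Qed.

(* Duality: pair the coefficients with a k := conj (w k t), so that the sum of
   squares is the real part of an integral of q against a trigonometric
   polynomial, whose L2 norm over the whole period is explicit. *)
Lemma bessel_le (q : R -> R[i]) (Q : R -> R) (w : int -> R -> R[i])
    (s : seq int) (t : R) :
  primitive T Q (fun r => norm2 (q r)) -> Q 0 = 0 ->
  (forall k, cprimitive T (w k) (fun r => half * q r * expi (frequency k * r))) ->
  (forall k, w k 0 = 0) -> uniq s -> 0 <= t <= T ->
  \sum_(k <- s) norm2 (w k t) <= T / 4 * Q T.
Proof.
move=> pQ Q0 pw w0 us /andP[t0 tT].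
pose a k := conjc (w k t); set X := \sum_(k <- s) _.
have [S [pS ST]] := trigonometric_norm2 a us.
have Xa : \sum_(k <- s) norm2 (a k) = X.
  by apply: eq_bigr => k _; rewrite norm2_conj.
rewrite Xa in ST.
have pW : cprimitive T (fun r => \sum_(k <- s) a k * w k r)
   (fun r => \sum_(k <- s) a k * (half * q r * expi (frequency k * r))).
  by apply: cprimitive_sum => k; exact: (cprimitiveZ T_ge0 _ (pw k)).
(* Young's inequality with weight [T / 4] produces the coefficients [T / 8] and [(2 * T)^-1]. By
   Parseval the second contributes at most [X / 2], which the left-hand side absorbs. *)
have := primitive_le (primitiveD pW.1
  (primitiveN T_ge0 (primitiveD (primitiveZ (T / 8) T_ge0 pQ)
     (primitiveZ (2 * T)^-1 T_ge0 pS)))) _ (lexx 0) t0 tT.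
have -> : complex.Re (\sum_(k <- s) a k * w k t) = X.
  by rewrite Re_sum; apply: eq_bigr => k _; rewrite mulrC mulr_conj.
have -> : complex.Re (\sum_(k <- s) a k * w k 0) = 0.
  by rewrite big1// => k _; rewrite w0 mulr0.
rewrite Q0 => main.
have {}main : X <= T / 8 * Q t + (S t - S 0) / (2 * T).
  suff : X - (T / 8 * Q t + (2 * T)^-1 * S t) <=
    0 - (T / 8 * 0 + (2 * T)^-1 * S 0) by lra.
  apply: main => r _; rewrite subr_le0.
  set P := \sum_(k <- s) a k * expi (frequency k * r).
  rewrite (_ : \sum_(k <- s) _ = q r * (half * P)); last first.
    by rewrite mulr_sumr mulr_sumr; apply: eq_bigr => k _; ring.
  have T40 : 0 < T / 4 by rewrite divr_gt0.
  apply: le_trans (Re_mul_le _ _ T40) _; rewrite norm2M norm2_half.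
  rewrite le_eqVlt; apply/orP; left; apply/eqP; field.
  by rewrite gt_eqF.
(* Parseval holds only over the full period, so the integrals up to [t] are enlarged to [T]; their
   integrands are nonnegative. *)
have SS : S t <= S T.
  have := primitive_le (primitiveN T_ge0 pS) _ t0 tT (lexx T).
  by rewrite lerN2; apply => r _; rewrite oppr_le0 norm2_ge0.
have QQ : Q t <= Q T.
  have := primitive_le (primitiveN T_ge0 pQ) _ t0 tT (lexx T).
  by rewrite lerN2; apply => r _; rewrite oppr_le0 norm2_ge0.
have S2 : (S t - S 0) / (2 * T) <= X / 2.
  have -> : X / 2 = (S T - S 0) / (2 * T) by rewrite ST; field; rewrite gt_eqF.
  by rewrite ler_wpM2r ?invr_ge0 ?mulr_ge0// lerD2r.
have Q2 : T / 8 * Q t <= T / 8 * Q T by rewrite ler_wpM2l ?divr_ge0.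
lra.
Qed.

End bessel.

(** * The first row of the fundamental solution *)

Section first_row.
Variables (R : realType) (T : R) (q f g : R -> R[i]) (l : R[i]).
Hypothesis T_gt0 : 0 < T.
Let T_ge0 : 0 <= T := ltW T_gt0.
Local Notation I_ := (0 +i* 1 : R[i]).
Hypothesis f_prim : cprimitive T f
  (fun t => half R * (I_ * l * f t - conjc (q t) * g t)).
Hypothesis g_prim : cprimitive T g
  (fun t => half R * (q t * f t - I_ * l * g t)).
Hypothesis f0 : f 0 = 1.
Hypothesis g0 : g 0 = 0.

(* The potential enters through a skew-Hermitian matrix, so only Im l
   contributes to the growth of |f|^2 + |g|^2. *)
Lemma first_row_energy (C0 t : R) : `|complex.Im l| <= C0 -> 0 <= t <= T ->
  norm2 (f t) + norm2 (g t) <= expR (C0 * T).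
Proof.
move=> lC0 /andP[t0 tT].
have C00 : 0 <= C0 by rewrite (le_trans _ lC0).
(* Gronwall's argument: with this integrating factor the energy becomes nonincreasing. *)
have pE : primitive T (fun r => expR (- C0 * r)) (fun r => - C0 * expR (- C0 * r)).
  apply: (@primitive_smooth _ _ _ _ C0) => [r|r /andP[r0 rT]].
    exact: (is_derive_scale_arg (is_derive_expR _)).
  rewrite normrM normrN (ger0_norm C00) ger0_norm ?expR_ge0// ler_piMr//.
  by rewrite -expR0 ler_expR mulNr oppr_le0 mulr_ge0.
have := primitive_le (primitiveM T_ge0
  (primitiveD (primitive_norm2 T_ge0 f_prim) (primitive_norm2 T_ge0 g_prim)) pE)
  _ (lexx 0) t0 tT.
have -> : norm2 (f 0) + norm2 (g 0) = 1.
  by rewrite f0 g0 /norm2/= expr1n !expr0n/= !addr0.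
rewrite mulr0 expR0 mulr1 => main.
have {}main : (norm2 (f t) + norm2 (g t)) * expR (- C0 * t) <= 1.
  apply: main => r _.
  have -> : 2 * complex.Re (conjc (f r) * (half R * (I_ * l * f r - conjc (q r) * g r)))
      + 2 * complex.Re (conjc (g r) * (half R * (q r * f r - I_ * l * g r)))
      = - complex.Im l * (norm2 (f r) - norm2 (g r)).
    by rewrite !complexRI/= /norm2; field.
  rewrite mulrCA mulrA -mulrDl mulrC pmulr_rle0 ?expR_gt0//.
  have /andP[l1 l2] : - C0 <= complex.Im l <= C0 by rewrite -ler_norml.
  have h1 : 0 <= (C0 + complex.Im l) * norm2 (f r).
    by rewrite mulr_ge0 ?norm2_ge0// -lerBlDl sub0r.
  have h2 : 0 <= (C0 - complex.Im l) * norm2 (g r).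
    by rewrite mulr_ge0 ?norm2_ge0// subr_ge0.
  lra.
apply: le_trans (_ : _ <= expR (C0 * t)) _; last first.
  by rewrite ler_expR ler_wpM2l.
by move: main; rewrite mulNr expRN ler_pdivrMr ?expR_gt0// mul1r.
Qed.

(* With p = e^(i nu t/2), the function p g - w p^* f subtracts from p g its
   first-order approximation: in its derivative the term in q alone cancels. *)
Lemma first_row_remainder (nu C B : R) (Q Y : R -> R) (w : R -> R[i]) :
  (forall t, 0 <= t <= T -> norm2 (f t) + norm2 (g t) <= C) ->
  primitive T Q (fun t => norm2 (q t)) -> Q 0 = 0 ->
  cprimitive T w (fun t => half R * q t * expi (nu * t)) -> w 0 = 0 ->
  (forall t, 0 <= t <= T -> norm2 (w t) <= B) ->
  primitive T Y (fun t => norm2 (w t)) -> Y 0 = 0 ->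
  norm2 (g T) <= 2 * (C * (1 + B) * T ^+ 2) * norm2 (l - nu%:C)
    + C * (Q T + 1) * Y T + 2 * C * norm2 (w T).
Proof.
move=> NC pQ Q0 pw w0 wB pY Y0.
have T0T : 0 <= T <= T by rewrite T_ge0 lexx.
have fC t : 0 <= t <= T -> norm2 (f t) <= C.
  by move=> /NC; apply: le_trans; rewrite lerDl norm2_ge0.
have gC t : 0 <= t <= T -> norm2 (g t) <= C.
  by move=> /NC; apply: le_trans; rewrite lerDr norm2_ge0.
have C0 : 0 <= C by rewrite (le_trans _ (fC T T0T))// norm2_ge0.
have B0 : 0 <= B by rewrite (le_trans _ (wB T T0T))// norm2_ge0.
have QT : 0 <= Q T.
  have := primitive_le (primitiveN T_ge0 pQ) _ (lexx 0) T_ge0 (lexx T).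
  by rewrite Q0 oppr0 oppr_le0; apply => t _; rewrite oppr_le0 norm2_ge0.
pose e := l - nu%:C.
pose p t : R[i] := expi (nu / 2 * t).
have pp : cprimitive T p (fun t => (0 +i* (nu / 2)) * p t) by exact: cprimitive_expi.
have p2 t : expi (nu * t) = p t * p t.
  by rewrite -expiD; congr expi; field.
have pc t : p t * conjc (p t) = 1 by rewrite mulr_conj norm2_expi.
pose H t := p t * g t - w t * conjc (p t) * f t.
(* The derivative of [H] is [A + conj q * D]: [A] carries the deviation of [l] from [nu], and [D] is
   of the size of [w]. *)
pose A t := half R * - (I_ * e) * (p t * g t + w t * conjc (p t) * f t).
pose D t := half R * w t * conjc (p t) * g t.
have pH : cprimitive T H (fun t => A t + conjc (q t) * D t).
  have pwpf := cprimitiveM T_ge0 (cprimitiveM T_ge0 pw (cprimitive_conj T_ge0 pp)) f_prim.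
  have := cprimitiveD (cprimitiveM T_ge0 pp g_prim) (cprimitiveN T_ge0 pwpf).
  apply: cprimitive_congr => // t.
  rewrite p2 conjcM /A /D /e.
  have -> : conjc (0 +i* (nu / 2)) = - (half R * (I_ * nu%:C)).
    by apply: complex_eq; rewrite !complexRI/=; field.
  have -> : 0 +i* (nu / 2) = half R * (I_ * nu%:C).
    by apply: complex_eq; rewrite !complexRI/=; field.
  have -> : half R * q t * (p t * p t) * conjc (p t) = half R * q t * p t.
    by rewrite -!mulrA pc mulr1.
  ring.
have H0 : H 0 = 0 by rewrite /H g0 w0 !mul0r mulr0 subr0.
set X := norm2 (H T).
have X0 : 0 <= X by exact: norm2_ge0.
(* The derivative of [rhs] dominates that of the real part of [conj (H T) * H]. Each of its two
   terms in [X] contributes at most [X / 4] at time [T], so half of [X] is absorbed. Using [Q T + 1]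
   avoids division by zero for a vanishing potential. *)
pose K1 := norm2 e * (C * (1 + B) * T / 2).
pose rhs t := (X / (4 * T) + K1) * t + (X / (4 * (Q T + 1)) * Q t
  + C * (Q T + 1) / 4 * Y t).
have prhs : primitive T rhs (fun t => (X / (4 * T) + K1) * 1
   + (X / (4 * (Q T + 1)) * norm2 (q t) + C * (Q T + 1) / 4 * norm2 (w t))).
  have pid : primitive T (fun t => t) (fun=> 1).
    by apply: (@primitive_smooth _ _ _ _ 1) => // t; rewrite normr1.
  exact: (primitiveD (primitiveZ _ T_ge0 pid)
    (primitiveD (primitiveZ _ T_ge0 pQ) (primitiveZ _ T_ge0 pY))).
have := primitive_le (primitiveD (cprimitiveZ T_ge0 (conjc (H T)) pH).1
  (primitiveN T_ge0 prhs)) _ (lexx 0) T_ge0 (lexx T).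
have -> : complex.Re (conjc (H T) * H T) = X by rewrite mulrC mulr_conj.
have rhs0 : rhs 0 = 0 by rewrite /rhs Q0 Y0 !mulr0 !addr0.
rewrite H0 mulr0 rhs0 subr0 subr_le0 => main.
have {}main : X <= (X / (4 * T) + K1) * T + (X / (4 * (Q T + 1)) * Q T
    + C * (Q T + 1) / 4 * Y T).
  apply: main => t /andP[/ltW t0 /ltW tT].
  have t0T : 0 <= t <= T by rewrite t0 tT.
  rewrite subr_le0 mulr1 mulrDr ReD [X in _ + complex.Re X]mulrA; apply: lerD.
    have T20 : 0 < (2 * T)^-1 by rewrite invr_gt0 mulr_gt0.
    apply: le_trans (Re_mul_le _ _ T20) _; rewrite norm2_conj -/X invrK.
    have nA : norm2 (A t) <= 4^-1 * norm2 e * (2 * C * (1 + B)).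
      rewrite /A norm2M [norm2 (half R * _)]norm2M norm2_half.
      have -> : norm2 (- (I_ * e)) = norm2 e by rewrite /norm2 !complexRI/=; ring.
      rewrite ler_wpM2l ?mulr_ge0 ?norm2_ge0//.
      apply: le_trans (norm2D_le _ _) _; rewrite !norm2M norm2_conj !norm2_expi.
      have : norm2 (w t) * norm2 (f t) <= B * C.
        by rewrite ler_pM ?norm2_ge0 ?wB ?fC.
      have := gC t t0T; lra.
    have {}nA : norm2 (A t) * (2 * T) <= 4^-1 * norm2 e * (2 * C * (1 + B)) * (2 * T).
      by rewrite ler_wpM2r// mulr_ge0.
    have -> : X / (4 * T) = (2 * T)^-1 * X / 2 by field; rewrite gt_eqF.
    rewrite /K1; lra.
  (* The factor [conj q] is grouped with [conj (H T)], so Young's inequality separates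
     [X * norm2 (q t)], integrated by [Q], from a multiple of [norm2 (w t)], integrated by [Y]. *)
  have Q20 : 0 < (2 * (Q T + 1))^-1 by rewrite invr_gt0 mulr_gt0// ltr_wpDl.
  apply: le_trans (Re_mul_le _ _ Q20) _; rewrite norm2M !norm2_conj -/X invrK.
  have nD : norm2 (D t) <= 4^-1 * norm2 (w t) * C.
    rewrite /D !norm2M norm2_half norm2_conj norm2_expi mulr1.
    by rewrite ler_wpM2l ?gC// mulr_ge0 ?norm2_ge0.
  have {}nD : norm2 (D t) * (2 * (Q T + 1)) <=
      4^-1 * norm2 (w t) * C * (2 * (Q T + 1)).
    by rewrite ler_wpM2r// mulr_ge0// addr_ge0.
  have -> : X / (4 * (Q T + 1)) * norm2 (q t) =
    (2 * (Q T + 1))^-1 * (X * norm2 (q t)) / 2 by field; rewrite gt_eqF// ltr_wpDl.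
  lra.
have XT : X / (4 * T) * T = X / 4 by field; rewrite gt_eqF.
have XQ : X / (4 * (Q T + 1)) * Q T <= X / 4.
  have -> : X / (4 * (Q T + 1)) * Q T = X / 4 * (Q T / (Q T + 1)).
    by field; rewrite gt_eqF// ltr_wpDl.
  rewrite ler_piMr ?divr_ge0// ler_pdivrMr ?ltr_wpDl// mul1r lerDl ler01 //.
have XK : X <= 2 * (K1 * T) + C * (Q T + 1) / 2 * Y T by lra.
have gT : p T * g T = H T + w T * conjc (p T) * f T by rewrite /H subrK.
have : norm2 (g T) = norm2 (p T * g T) by rewrite norm2M norm2_expi mul1r.
rewrite gT => ->; apply: le_trans (norm2D_le _ _) _; rewrite -/X !norm2M.
rewrite norm2_conj norm2_expi mulr1.
have : norm2 (w T) * norm2 (f T) <= norm2 (w T) * C.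
  by rewrite ler_wpM2l ?norm2_ge0 ?fC.
have -> : 2 * (C * (1 + B) * T ^+ 2) * norm2 (l - nu%:C) = 4 * (K1 * T).
  by rewrite /K1 /e; field.
lra.
Qed.

End first_row.

(** * Summability *)

(** The terms are nonnegative, so the unordered sum is the supremum of its finite partial sums. This
    reduces summability to bounds over duplicate-free lists, as in [bessel_le]. *)
Lemma in_l2P (R : realType) (z : int -> R[i]) :
  in_l2 z <-> exists E : R, forall s : seq int, uniq s ->
    \sum_(k <- s) norm2 (z k) <= E.
Proof.
have nE k : `|(modulus (z k) ^+ 2)%:E|%E = (norm2 (z k))%:E.
  by rewrite modulus_sqr gee0_abs// lee_fin norm2_ge0.
rewrite /in_l2 /summable; under eq_esum do rewrite nE.
split=> [lt_oo|[E hE]].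
  exists (fine (\esum_(k in [set: int]) (norm2 (z k))%:E)) => s us.
  rewrite -lee_fin fineK; last first.
    by rewrite ge0_fin_numE//; apply: esum_ge0 => k _; rewrite lee_fin norm2_ge0.
  rewrite -sumEFin; apply: esum_ge; exists [set` s].
    by split; [exact: finite_seq|].
  by rewrite fsbig_seq.
apply: (@le_lt_trans _ _ E%:E); last exact: ltry.
apply: ge_ereal_sup => _ [X [finX _] <-].
by rewrite fsbig_finite// sumEFin lee_fin; apply: hE; exact: finmap.fset_uniq.
Qed.

(** * Existence of the primitives built from the potential *)

Section coefficients.
Variables (R : realType) (T : R) (q : R -> R[i]).
Hypotheses (T_gt0 : 0 < T) (qL2 : in_L2 T q).

Lemma Re_le_norm2 (z : R[i]) : `|complex.Re z| <= 1 + norm2 z.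
Proof. by rewrite /norm2 ler_norml; apply/andP; split; nra. Qed.

Lemma Im_le_norm2 (z : R[i]) : `|complex.Im z| <= 1 + norm2 z.
Proof. by rewrite /norm2 ler_norml; apply/andP; split; nra. Qed.

Lemma fourier_primitive (nu : R) : exists w : R -> R[i],
  cprimitive T w (fun t => half R * q t * expi (nu * t)) /\ w 0 = 0.
Proof.
have [mRe mIm _] := qL2.
have nq t : norm2 (half R * q t * expi (nu * t)) <= norm2 (q t).
  by rewrite !norm2M norm2_half norm2_expi mulr1 ler_piMl ?norm2_ge0// invf_le1// ler1n.
have mcos : measurable_fun `[0, T] (fun t : R => cos (nu * t)).
  apply: measurable_funTS; apply: continuous_measurable_fun => t.
  apply: continuous_comp; last exact: continuous_cos.
  exact: mulrl_continuous.
have msin : measurable_fun `[0, T] (fun t : R => sin (nu * t)).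
  apply: measurable_funTS; apply: continuous_measurable_fun => t.
  apply: continuous_comp; last exact: continuous_sin.
  exact: mulrl_continuous.
have [|t _|G1 [p1 G10]] := @in_L2_primitive R T q qL2
    (fun t => complex.Re (half R * q t * expi (nu * t))) 1.
- rewrite (_ : (fun t => _) = (fun t => 2^-1 * complex.Re (q t) * cos (nu * t)
      - 2^-1 * complex.Im (q t) * sin (nu * t))); last first.
    by apply/funext => t; rewrite !complexRI/=; ring.
  by apply: measurable_funB; apply: measurable_funM => //; exact: measurable_funM.
- by rewrite mul1r (le_trans (Re_le_norm2 _))// lerD2l.
have [|t _|G2 [p2 G20]] := @in_L2_primitive R T q qL2
    (fun t => complex.Im (half R * q t * expi (nu * t))) 1.
- rewrite (_ : (fun t => _) = (fun t => 2^-1 * complex.Re (q t) * sin (nu * t)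
      + 2^-1 * complex.Im (q t) * cos (nu * t))); last first.
    by apply/funext => t; rewrite !complexRI/=; ring.
  by apply: measurable_funD; apply: measurable_funM => //; exact: measurable_funM.
- by rewrite mul1r (le_trans (Im_le_norm2 _))// lerD2l.
by exists (fun t => G1 t +i* G2 t); split; [split|rewrite G10 G20].
Qed.

Lemma norm2_primitive : exists Q : R -> R,
  primitive T Q (fun t => norm2 (q t)) /\ Q 0 = 0.
Proof.
apply: (in_L2_primitive (C := 1) qL2); first exact: measurable_norm2 qL2.
by move=> t _; rewrite ger0_norm ?norm2_ge0// mul1r lerDr.
Qed.

Lemma bounded_norm2_primitive (w w' : R -> R[i]) (B : R) :
  cprimitive T w w' -> (forall t, 0 <= t <= T -> norm2 (w t) <= B) ->
  exists Y : R -> R, primitive T Y (fun t => norm2 (w t)) /\ Y 0 = 0.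
Proof.
move=> pw wB; have B0 : 0 <= B.
  by rewrite (le_trans _ (wB 0 _)) ?norm2_ge0// lexx ltW.
apply: (in_L2_primitive (C := B) qL2).
  apply: subspace_continuous_measurable_fun => //.
  exact: primitive_within (primitive_norm2 (ltW T_gt0) pw).
move=> t tT; rewrite ger0_norm ?norm2_ge0// (le_trans (wB t tT))// ler_peMr//.
by rewrite lerDl norm2_ge0.
Qed.

End coefficients.

Lemma norm2_signz (R : realType) (k : int) : norm2 ((-1 : R[i]) ^ k) = 1.
Proof.
apply/eqP; rewrite -(@eqrXn2 _ 2)// ?norm2_ge0//.
rewrite expr2 -norm2M -expfzMl mulrNN mulr1 exp1rz.
by rewrite /norm2/= !expr1n expr0n addr0.
Qed.

Lemma half_inv2 (R : realType) : half R = 2^-1.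
Proof. by rewrite /half fmorphV/= (rmorph_nat (real_complex R)). Qed.

Lemma mulmx_alpha00 (R : realType) (q : R -> R[i]) (t : R) (l : R[i])
    (A : 'M[R[i]]_2) :
  (A *m alpha q t l) 0 0 = half R * ((0 +i* 1) * l * A 0 0 - conjc (q t) * A 0 1).
Proof.
rewrite mxE !big_ord_recl big_ord0 !mxE/= half_inv2.
by rewrite (_ : lift ord0 ord0 = 1); [ring|exact: val_inj].
Qed.

Lemma mulmx_alpha01 (R : realType) (q : R -> R[i]) (t : R) (l : R[i])
    (A : 'M[R[i]]_2) :
  (A *m alpha q t l) 0 1 = half R * (q t * A 0 0 - (0 +i* 1) * l * A 0 1).
Proof.
rewrite mxE !big_ord_recl big_ord0 !mxE/= half_inv2.
by rewrite (_ : lift ord0 ord0 = 1); [ring|exact: val_inj].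
Qed.

Theorem proposition4p3 (R : realType) (T : R) (q : R -> R[i])
    (F : R -> R[i] -> 'M[R[i]]_2) (M : R[i] -> 'M[R[i]]_2)
    (lam : int -> R[i])
    (T_gt0 : 0 < T)
    (q_per : forall t : R, q (t + T) = q t)
    (q_L2 : in_L2 T q)
    (F_sol : is_fundamental_solution T q F)
    (M_def : forall l : R[i], M l = F T l)
    (lam_zeros : enumerates_zeros (fun l : R[i] => M l 0 0 - M l 1 1) lam)
    (lam_asym : in_l2 (fun k : int => lam k - free_zero T k)) :
  in_l2 (pert_fourier M lam).
Proof.
have T_ge0 := ltW T_gt0.
have f_prim l : cprimitive T (fun t => F t l 0 0)
    (fun t => half R * ((0 +i* 1) * l * F t l 0 0 - conjc (q t) * F t l 0 1)).
  have [_ acF dF] := F_sol l.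
  apply: abs_continuous_cprimitive; first exact: acF.
  apply: (@filterS _ _ (ae_filter_ringOfSetsType _) _ _ _ dF) => t dFt tT.
  by rewrite -mulmx_alpha00; exact: dFt.
have g_prim l : cprimitive T (fun t => F t l 0 1)
    (fun t => half R * (q t * F t l 0 0 - (0 +i* 1) * l * F t l 0 1)).
  have [_ acF dF] := F_sol l.
  apply: abs_continuous_cprimitive; first exact: acF.
  apply: (@filterS _ _ (ae_filter_ringOfSetsType _) _ _ _ dF) => t dFt tT.
  by rewrite -mulmx_alpha01; exact: dFt.
have f0 l : F 0 l 0 0 = 1 by have [-> _ _] := F_sol l; rewrite mxE.
have g0 l : F 0 l 0 1 = 0 by have [-> _ _] := F_sol l; rewrite mxE.
have [Q [pQ Q0]] := norm2_primitive q_L2.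
have [w /all_and2[pw w0]] := choice (fun k => fourier_primitive q_L2 (frequency T k)).
pose B := T / 4 * Q T.
have wB k t : 0 <= t <= T -> norm2 (w k t) <= B.
  move=> tT; have := bessel_le T_gt0 pQ Q0 pw w0 (isT : uniq [:: k]) tT.
  by rewrite big_seq1.
have [Y /all_and2[pY Y0]] :=
  choice (fun k => bounded_norm2_primitive T_gt0 q_L2 (pw k) (wB k)).
have /in_l2P[E hE] := lam_asym.
(* The free zeros are real, and a single term of the convergent sum is at most [E]; hence one energy
   bound [C] serves all [k]. *)
have Im_lam k : `|complex.Im (lam k)| <= 1 + E.
  have -> : complex.Im (lam k) = complex.Im (lam k - free_zero T k).
    by rewrite ImD ImN /= subr0.
  apply: le_trans (Im_le_norm2 _) _; rewrite lerD2l.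
  by have := hE [:: k] isT; rewrite big_seq1.
pose C := expR ((1 + E) * T).
have C0 : 0 <= C by exact: expR_ge0.
have NC k t : 0 <= t <= T -> norm2 (F t (lam k) 0 0) + norm2 (F t (lam k) 0 1) <= C.
  by move=> tT; apply: (first_row_energy T_gt0 (f_prim _) (g_prim _)).
pose K1 := 2 * (C * (1 + B) * T ^+ 2); pose K2 := C * (Q T + 1).
have bk k : norm2 (F T (lam k) 0 1) <=
    K1 * norm2 (lam k - free_zero T k) + K2 * Y k T + 2 * C * norm2 (w k T).
  exact: (first_row_remainder T_gt0 (f_prim _) (g_prim _) (g0 _) (@NC k) pQ Q0 (pw k)
    (w0 k) (wB k) (pY k) (Y0 k)).
have T0T : 0 <= T <= T by rewrite T_ge0 lexx.
have B0 : 0 <= B by rewrite (le_trans _ (wB 0 T T0T))// norm2_ge0.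
have QT : 0 <= Q T by move: B0; rewrite pmulr_rge0// divr_gt0.
(* The 4 is the squared modulus of the factor [2 * (-1) ^ k]; the three terms bound the sums of the
   three parts of [bk]. *)
apply/in_l2P; exists (4 * (K1 * E + K2 * (B * T) + 2 * C * B)) => s us.
have zE k : norm2 (pert_fourier M lam k) = 4 * norm2 (F T (lam k) 0 1).
  rewrite /pert_fourier M_def 2!norm2M norm2_signz mulr1; congr (_ * _).
  by rewrite -[2]/(1 + 1) /norm2 ReD ImD/=; ring.
under eq_bigr do rewrite zE.
rewrite -mulr_sumr ler_wpM2l//.
apply: le_trans (ler_sum _ (fun k _ => bk k)) _.
rewrite !big_split/= -!mulr_sumr; apply: lerD; first apply: lerD.
- rewrite ler_wpM2l ?hE// !mulr_ge0// ?addr_ge0// exprn_ge0//.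
- rewrite ler_wpM2l ?mulr_ge0 ?addr_ge0//.
  (* Bessel's bound [B] on the sum of [norm2 (w k t)], uniform in [t], is integrated over [[0, T]]
     to bound the sum of the [Y k T] by [B * T]. *)
  have pBt : primitive T (fun t => B * t) (fun=> B).
    apply: (@primitive_smooth _ _ _ _ `|B|) => // t.
    by apply: is_derive_eq; rewrite /GRing.scale/= mulr1.
  have := primitive_le (primitiveD (primitive_sum s pY) (primitiveN T_ge0 pBt)) _
    (lexx 0) T_ge0 (lexx T).
  rewrite [X in _ <= X - _]big1 ?mulr0 ?subr0 ?subr_le0//; apply.
  move=> t /andP[/ltW t0 /ltW tT]; rewrite subr_le0.
  by apply: bessel_le pQ Q0 pw w0 us _; rewrite ?t0.
- rewrite ler_wpM2l ?mulr_ge0//.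
  exact: bessel_le pQ Q0 pw w0 us T0T.
Qed.
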